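(* Let $N,p$ be positive integers with $p<N$, let $\mathbf{B}\in\mathbb{R}^{N\times N}$ be the (symmetric, strictly positive definite) background error covariance matrix, let $\widehat{\mathbf{R}}\in\mathbb{R}^{p\times p}$ be the (symmetric, strictly positive definite) block diagonal observation error covariance matrix, and let $\widehat{\mathbf{H}}\in\mathbb{R}^{p\times N}$ be the generalised observation operator. Let $\widehat{\mathbf{S}}=\mathbf{I}_N+\mathbf{B}^{1/2}\widehat{\mathbf{H}}^T\widehat{\mathbf{R}}^{-1}\widehat{\mathbf{H}}\mathbf{B}^{1/2}$ be the Hessian of the preconditioned 4D-Var problem. Then $$1+\max\left\{\frac{\lambda_p(\widehat{\mathbf{H}}\widehat{\mathbf{H}}^T)\,\lambda_N(\mathbf{B})}{\lambda_p(\widehat{\mathbf{R}})},\ \frac{\lambda_1(\widehat{\mathbf{H}}\widehat{\mathbf{H}}^T)\,\lambda_N(\mathbf{B})}{\lambda_1(\widehat{\mathbf{R}})}\right\}\le\kappa(\widehat{\mathbf{S}})\le 1+\frac{\lambda_1(\mathbf{B})}{\lambda_p(\widehat{\mathbf{R}})}\,\lambda_1(\widehat{\mathbf{H}}\widehat{\mathbf{H}}^T).$$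
   Context: Setting: $n\ge 0$ is an integer; for $i=0,\dots,n$, $p_i$ is the number of observations at time $t_i$ and $p=\sum_{i=0}^n p_i$ is the total number of observations; $N$ is the number of state variables. The matrices $\mathbf{H}_i\in\mathbb{R}^{p_i\times N}$ are the linearised observation operators, $\mathbf{M}_i\in\mathbb{R}^{N\times N}$ ($i=1,\dots,n$) the linearised model operators, and $\widehat{\mathbf{M}}_i=\mathbf{M}_i\cdots\mathbf{M}_1$. The generalised observation operator is the stacked matrix $\widehat{\mathbf{H}}=\left[\mathbf{H}_0^T,(\mathbf{H}_1\widehat{\mathbf{M}}_1)^T,\dots,(\mathbf{H}_n\widehat{\mathbf{M}}_n)^T\right]^T\in\mathbb{R}^{p\times N}$. $\widehat{\mathbf{R}}\in\mathbb{R}^{p\times p}$ is block diagonal with diagonal blocks $\mathbf{R}_i\in\mathbb{R}^{p_i\times p_i}$, the observation error covariance matrices. $\mathbf{B}$ and all $\mathbf{R}_i$ (hence $\widehat{\mathbf{R}}$) are symmetric and strictly positive definite; no further structure is assumed. $\mathbf{B}^{1/2}$ is the unique symmetric positive definite square root of $\mathbf{B}$. When $n=0$, $\widehat{\mathbf{H}}=\mathbf{H}_0$ and $\widehat{\mathbf{R}}=\mathbf{R}_0$ (the 3D-Var case). Notation: for a $k\times k$ matrix $\mathbf{A}$ with real eigenvalues, $\lambda_1(\mathbf{A})\ge\lambda_2(\mathbf{A})\ge\dots\ge\lambda_k(\mathbf{A})$ are its eigenvalues in decreasing order, counted with multiplicity. For symmetric positive definite $\mathbf{A}\in\mathbb{R}^{k\times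 k}$, $\kappa(\mathbf{A})=\|\mathbf{A}\|_2\|\mathbf{A}^{-1}\|_2=\lambda_1(\mathbf{A})/\lambda_k(\mathbf{A})$ is the 2-norm condition number. *)

(* Defs.v *)
From HB Require Import structures.
From mathcomp Require Import all_boot all_order all_algebra.
From mathcomp Require Import sesquilinear polyrcf.
From mathcomp Require Import boolp classical_sets reals.

Set Implicit Arguments.
Unset Strict Implicit.
Unset Printing Implicit Defensive.

Import Order.TTheory GRing.Theory Num.Theory.
Local Open Scope classical_set_scope.
Local Open Scope ring_scope.

(* Real roots of the characteristic polynomial in decreasing order, repeated
   according to multiplicity ([rootsR] lists the distinct roots increasingly).
   It lists all eigenvalues exactly when these are all real, as for symmetric
   matrices; see [spectrumE]. *)
Definition spectrum (R : realType) k (A : 'M[R]_k) : seq R :=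
  flatten [seq nseq (mup x (char_poly A)) x | x <- rev (rootsR (char_poly A))].

(* Eigenvalues are numbered from 1: [lambda 1 A] is the largest one and
   [lambda k A] the smallest one of a k x k matrix. *)
Definition lambda (R : realType) k (i : nat) (A : 'M[R]_k) : R :=
  nth 0 (spectrum A) i.-1.

Definition spd (R : realType) k (A : 'M[R]_k) : Prop :=
  A \is symmetricmx /\
  forall x : 'cV[R]_k, x != 0 -> 0 < (x^T *m A *m x) 0 0.

(* The definite description is meaningful for [spd A], in which case exactly
   one matrix qualifies; the value [0] is a default for other arguments. *)
Definition sqrtmx (R : realType) k (A : 'M[R]_k) : 'M[R]_k :=
  xget 0 [set C : 'M[R]_k | spd C /\ C *m C = A].

Definition enorm (R : realType) k (x : 'cV[R]_k) : R :=
  Num.sqrt (\sum_i x i 0 ^+ 2).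

Definition mxnorm2 (R : realType) m k (A : 'M[R]_(m, k)) : R :=
  sup [set enorm (A *m x) | x in [set x : 'cV[R]_k | enorm x <= 1]].

Definition cond2 (R : realType) k (A : 'M[R]_k) : R :=
  mxnorm2 A * mxnorm2 (invmx A).

(* M_i ... M_1, the empty product (i = 0) being the identity. Only the values
   [M 1], ..., [M i] matter. *)
Fixpoint model_prod (R : realType) N (M : nat -> 'M[R]_N) (i : nat) : 'M[R]_N :=
  if i is j.+1 then M j.+1 *m model_prod M j else 1%:M.

Definition gen_obs (R : realType) n (p_ : 'I_n.+1 -> nat) N
    (H_ : forall i, 'M[R]_(p_ i, N)) (M : nat -> 'M[R]_N) :
    'M[R]_(\sum_i p_ i, N) :=
  \mxcol_(i < n.+1) (H_ i *m model_prod M i).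

Definition gen_obs_cov (R : realType) n (p_ : 'I_n.+1 -> nat)
    (R_ : forall i, 'M[R]_(p_ i)) : 'M[R]_(\sum_i p_ i) :=
  \mxdiag_(i < n.+1) R_ i.

Definition precond_hessian (R : realType) N p (B : 'M[R]_N)
    (Rhat : 'M[R]_p) (Hhat : 'M[R]_(p, N)) : 'M[R]_N :=
  1%:M + sqrtmx B *m Hhat^T *m invmx Rhat *m Hhat *m sqrtmx B.

Lemma spectrumE (R : realType) k (A : 'M[R]_k) (s : seq R) :
  char_poly A = \prod_(x <- s) ('X - x%:P) -> spectrum A = sort >=%R s.
Proof.
move=> As; have P0 : char_poly A != 0 by rewrite monic_neq0 // char_poly_monic.
have ge_trans : transitive (>=%R : rel R).
  by move=> y x z /= xy yz; exact: le_trans yz xy.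
have ge_anti : antisymmetric (>=%R : rel R).
  by move=> x y /=; rewrite andbC => /le_anti.
have mupE x : mup x (char_poly A) = count_mem x s.
  rewrite As; elim: (s) => [|y t IHt] /=.
    by rewrite big_nil mupNroot // root1.
  rewrite big_cons mupM ?polyXsubC_eq0 ?IHt //; last first.
    by rewrite prodf_seq_neq0; apply/allP => z _; rewrite polyXsubC_eq0.
  by rewrite -['X - _]expr1 mup_XsubCX eq_sym; case: eqP.
have srt : sorted <%R (rootsR (char_poly A)) by exact: sorted_roots.
have uniq_r : uniq (rev (rootsR (char_poly A))).
  by rewrite rev_uniq (sorted_uniq lt_trans ltxx srt).
rewrite /spectrum; apply: (sorted_eq ge_trans ge_anti).
- have := srt; rewrite -rev_sorted; elim: (rev _) => //= y r IHr yr.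
  move: (yr); rewrite (path_sortedE (fun y x z xy yz => lt_trans yz xy)).
  case/andP=> /allP y_gt /IHr {}IHr; move: IHr; rewrite !(sorted_pairwise ge_trans).
  rewrite pairwise_cat => ->; rewrite andbT; apply/andP; split.
    apply/allrelP => a b /nseqP[-> _] /flatten_mapP[c cr /nseqP[-> _]].
    exact/ltW/y_gt.
  elim: (mup y _) => //= m ->; rewrite andbT.
  by apply/allP => a /nseqP[-> _] /=.
- by apply: sort_sorted => x y; exact: le_total.
apply/allP => x _ /=; apply/eqP.
transitivity (count_mem x s); last by apply/esym/permP; rewrite perm_sort.
have -> : count_mem x (flatten [seq nseq (mup y (char_poly A)) y
    | y <- rev (rootsR (char_poly A))])
  = ((x \in rev (rootsR (char_poly A))) * mup x (char_poly A))%N.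
  elim: (rev _) uniq_r => //= y r IHr /andP[yr /IHr {}IHr].
  rewrite count_cat count_nseq IHr in_cons /= (eq_sym y x).
  by case: (eqVneq x y) yr => [->/negPf-> | _ _]; rewrite ?mul1n ?mul0n ?addn0.
rewrite mupE; case: (boolP (x \in _)) => [|xr]; rewrite ?mul1n // mul0n -mupE.
rewrite mupNroot //; apply: contra xr => rx; rewrite mem_rev.
by rewrite -(roots_on_rootsR P0 x) rx in_itv.
Qed.

(* Main.v *)
Require Import Defs.
From mathcomp Require Import all_boot all_order all_algebra.
From mathcomp Require Import sesquilinear spectral complex ring lra.
From mathcomp Require Import classical_sets reals.

Set Implicit Arguments.
Unset Strict Implicit.
Unset Printing Implicit Defensive.

Import Order.TTheory GRing.Theory Num.Theory.
Local Open Scope ring_scope.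

(** Write [H] for the observation operator, [C] for the square root of [B],
    [W = H C] and [S = 1 + W^T Rhat^-1 W].

    The condition number is a norm.  The quadratic form of [S] dominates that
    of the identity, so [S^-1] does not increase norms; and [W] has fewer rows than
    columns, so some [v != 0] satisfies [W v = 0], hence [S v = v].  Therefore
    [S^-1] has norm 1 and [cond2 S = mxnorm2 S] ([cond2_fixed]), and this norm
    is the best constant [c] with [x . S x <= c (x . x)] ([form_le_mxnorm2],
    [mxnorm2_psd_le]).

    Upper bound ([cond2_hessian_le]).  In
    [x . S x = x . x + W x . Rhat^-1 (W x)] the last term is estimated factor
    by factor: [Rhat^-1] costs [1 / lambda p Rhat], then [H] costs
    [lambda 1 (H H^T)], and [C] costs [lambda 1 B].

    Lower bound ([cond2_hessian_ge]).  Both lower bounds come from a single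
    inequality between quadratic forms on the observation space
    ([obs_form_le]):
    [lambda N B * (y . H H^T y) <= (cond2 S - 1) * (y . Rhat y)].
    It is the Cauchy-Schwarz inequality for the pair [Rhat], [Rhat^-1] applied
    to [y] and [W W^T y].  Taking for [y] an eigenvector of [Rhat] for its
    smallest eigenvalue gives the first term of the maximum; an eigenvector of
    [H H^T] for its largest eigenvalue gives the second.

    What is used of spectral theory is that [lambda 1] and [lambda k] of a
    symmetric matrix are eigenvalues and bound the Rayleigh quotient
    ([lambda_eigenvector], [rayleigh]), and that a positive definite matrix has
    a positive definite square root ([sqrtmxP]).  All of it follows from
    [symmetric_spectral], the real form of the spectral theorem for complex
    hermitian matrices. *)

(** * Euclidean inner product and positive semidefinite forms *)

Definition dot (R : rcfType) k (x y : 'cV[R]_k) : R := (x^T *m y) 0 0.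

Section Dot.
Variables (R : rcfType) (k : nat).
Implicit Types (x y : 'cV[R]_k) (A : 'M[R]_k).

Lemma dotE x y : dot x y = \sum_i x i 0 * y i 0.
Proof. by rewrite /dot mxE; apply: eq_bigr => i _; rewrite mxE. Qed.

Lemma dotC x y : dot x y = dot y x.
Proof. by rewrite !dotE; apply: eq_bigr => i _; rewrite mulrC. Qed.

Lemma dotDr x y z : dot x (y + z) = dot x y + dot x z.
Proof. by rewrite /dot mulmxDr mxE. Qed.

Lemma dotZr x a y : dot x (a *: y) = a * dot x y.
Proof. by rewrite /dot -scalemxAr mxE. Qed.

Lemma dotDl x y z : dot (x + y) z = dot x z + dot y z.
Proof. by rewrite dotC dotDr !(dotC z). Qed.

Lemma dotZl a x y : dot (a *: x) y = a * dot x y.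
Proof. by rewrite dotC dotZr dotC. Qed.

Lemma dot_ge0 x : 0 <= dot x x.
Proof. by rewrite dotE sumr_ge0 // => i _; rewrite -expr2 sqr_ge0. Qed.

Lemma dot_eq0 x : (dot x x == 0) = (x == 0).
Proof.
apply/idP/eqP => [|->]; last by rewrite /dot mulmx0 mxE.
rewrite dotE psumr_eq0 => [/allP x0|i _]; last by rewrite -expr2 sqr_ge0.
apply/matrixP => i j; rewrite ord1 mxE; apply/eqP.
by have := x0 i (mem_index_enum i); rewrite /= mulf_eq0 orbb.
Qed.

Lemma dot_gt0 x : (0 < dot x x) = (x != 0).
Proof. by rewrite lt0r dot_eq0 dot_ge0 andbT. Qed.

(** The form is not assumed definite, so the discriminant argument needs care
    when [y] is isotropic: the proof evaluates the binary quadratic form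
    [(s, t) |-> z . A z], [z = s x - t y], at well chosen points. *)
Lemma psd_cauchy_schwarz A x y : A^T = A -> (forall z, 0 <= dot z (A *m z)) ->
  dot x (A *m y) ^+ 2 <= dot x (A *m x) * dot y (A *m y).
Proof.
move=> Asym Age0; have yx : dot y (A *m x) = dot x (A *m y).
  by rewrite dotC /dot trmx_mul Asym mulmxA.
have poly_ge0 s t : 0 <= s ^+ 2 * dot x (A *m x)
    - 2 * s * t * dot x (A *m y) + t ^+ 2 * dot y (A *m y).
  have := Age0 (s *: x - t *: y).
  rewrite mulmxBr -!scalemxAr -!scaleNr.
  by rewrite !(dotDr, dotDl, dotZr, dotZl) yx; congr (0 <= _); ring.
move: (dot x (A *m x)) (dot x (A *m y)) (dot y _) poly_ge0 => c b a H.
have a0 : 0 <= a by have := H 0 1; lra.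
have c0 : 0 <= c by have := H 1 0; lra.
have [a_gt0|a_le0] := ltP 0 a.
  have := H a b.
  have -> : a ^+ 2 * c - 2 * a * b * b + b ^+ 2 * a = a * (c * a - b ^+ 2) by ring.
  by rewrite pmulr_rge0 // subr_ge0.
have {a0 a_le0}a0 : a = 0 by apply/le_anti/andP.
(* With [a = 0] this point gives [0 <= - b ^+ 2 * (c + 2)], hence [b = 0]. *)
have := H b (c + 1); rewrite a0; nra.
Qed.

Lemma cauchy_schwarz x y : dot x y ^+ 2 <= dot x x * dot y y.
Proof.
have := @psd_cauchy_schwarz 1%:M x y; rewrite !mul1mx; apply.
  exact: trmx1.
by move=> z; rewrite mul1mx dot_ge0.
Qed.

End Dot.

Lemma dot_mulmx (R : rcfType) m k (A : 'M[R]_(m, k)) x y :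
  dot (A *m x) y = dot x (A^T *m y).
Proof. by rewrite /dot trmx_mul mulmxA. Qed.

(** A form that vanishes is positive semidefinite, so the Cauchy-Schwarz
    inequality annihilates the bilinear form as well. *)
Lemma form_eq0_mx (R : rcfType) k (A : 'M[R]_k) :
  A^T = A -> (forall x, dot x (A *m x) = 0) -> A = 0.
Proof.
move=> As A0; have AA0 x y : dot x (A *m y) = 0.
  have := psd_cauchy_schwarz x y As _; rewrite !A0 mulr0.
  move=> /(_ _)/= H; apply/eqP; rewrite -sqrf_eq0 eq_le sqr_ge0 andbT H //.
  by move=> z; rewrite A0.
apply/matrixP => i j; rewrite mxE.
by rewrite -(AA0 (delta_mx i 0) (delta_mx j 0)) /dot trmx_delta -rowE -colE !mxE.
Qed.

(** * Spectral theorem for real symmetric matrices *)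

Lemma char_poly_similar (F : fieldType) k (P A : 'M[F]_k) :
  P \in unitmx -> char_poly (invmx P *m A *m P) = char_poly A.
Proof.
move=> Pu; rewrite /char_poly /char_poly_mx !map_mxM /=.
have PV : map_mx polyC (invmx P) *m map_mx polyC P = 1%:M.
  by rewrite -map_mxM mulVmx // map_mx1.
have -> : 'X%:M - map_mx polyC (invmx P) *m map_mx polyC A *m map_mx polyC P =
    map_mx polyC (invmx P) *m ('X%:M - map_mx polyC A) *m map_mx polyC P.
  by rewrite mulmxBr mulmxBl mul_mx_scalar -scalemxAl PV scalemx1.
by rewrite !det_mulmx mulrAC -det_mulmx PV det1 mul1r.
Qed.

(** Here [w i] is the squared modulus of the [i]-th coordinate of [x] in a
    complex orthonormal eigenbasis.  That the weights do not depend on [q]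
    makes this a spectral measure: it handles [x . x], [x . A x] and the forms
    of all polynomials in [A] simultaneously, and it is a statement over [R]
    although the eigenbasis is taken over [R[i]]. *)
Lemma symmetric_spectral (R : rcfType) k (A : 'M[R]_k.+1) : A^T = A ->
  exists2 d : 'I_k.+1 -> R, char_poly A = \prod_(a <- codom d) ('X - a%:P) &
  forall x, exists2 w : 'I_k.+1 -> R, (forall i, 0 <= w i) &
  forall q : {poly R}, dot x (horner_mx A q *m x) = \sum_i q.[d i] * w i.
Proof.
move=> Asym; pose f : {rmorphism R -> R[i]} := real_complex R; pose AC := map_mx f A.
have realf (a : R) : f a \is Num.real by rewrite complex_real.
have conjf (a : R) : (f a)^* = f a by exact/CrealP/realf.
have ACherm : AC \is hermsymmx.
  apply: realsym_hermsym; last by apply/mxOverP => i j; rewrite mxE.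
  by rewrite qualifE /= expr0 scale1r map_mx_id // /AC map_trmx Asym.
pose P := spectralmx AC; pose D := spectral_diag AC.
have Pu : P \in unitmx by exact: spectral_unit.
have PV : invmx P = (P ^t*)%sesqui by rewrite invmx_unitary // spectral_unitarymx.
have ACE : AC = invmx P *m diag_mx D *m P.
  exact/orthomx_spectralP/hermitian_normalmx.
pose d i := complex.Re (D 0 i).
have dE i : f (d i) = D 0 i.
  by apply: RRe_real; exact: (mxOverP (hermitian_spectral_diag_real ACherm)).
exists d => [|x].
  apply: (@map_poly_inj _ _ f); rewrite map_char_poly -/AC ACE.
  rewrite char_poly_similar // char_poly_trig ?diag_mx_is_trig //.
  rewrite rmorph_prod /codom big_image /=; apply: eq_bigr => i _ /=.
  by rewrite !mxE eqxx mulr1n -dE map_polyXsubC.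
pose y := P *m map_mx f x.
pose w i := complex.Re (`|y i 0| ^+ 2).
have wE i : f (w i) = `|y i 0| ^+ 2.
  by apply: RRe_real; rewrite rpredX // normr_real.
exists w => [i|q]; first by rewrite -ler0c [_%:C%C]wE exprn_ge0.
apply: (@complexI R); rewrite -[LHS]/(f _) -[RHS]/(f _) rmorph_sum /=.
have -> : f (dot x (horner_mx A q *m x)) =
    ((map_mx f x)^T *m (horner_mx AC (map_poly f q) *m map_mx f x)) 0 0.
  by rewrite -map_horner_mx -map_mxM map_trmx -map_mxM [RHS]mxE.
have yE : (map_mx f x)^T *m invmx P = (y ^t*)%sesqui.
  rewrite PV /y trmx_mul map_mxM; congr (_ *m _).
  by apply/matrixP => i j; rewrite !mxE; exact/esym/conjf.
have -> : horner_mx AC (map_poly f q) =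
    invmx P *m diag_mx (map_mx (horner (map_poly f q)) D) *m P.
  by rewrite -horner_mx_diag -[in RHS]horner_mx_uconjC // -ACE.
rewrite -!mulmxA -/y (mulmxA _ (invmx P)) yE [LHS]mxE; apply: eq_bigr => i _.
rewrite mul_diag_mx !mxE rmorphM /= wE normCK -dE horner_map /=.
by rewrite [y i 0]mxE mulrCA [_^* * _]mulrC.
Qed.

Lemma lambda_eigenvector (R : realType) k i (A : 'M[R]_k) : A^T = A ->
  (0 < i <= k)%N -> exists2 v : 'cV_k, v != 0 & A *m v = lambda i A *: v.
Proof.
case: k A => [|k] A As; first by case/andP=> /leq_trans h /h.
move=> /andP[i_gt0 ik]; have [d Ad _] := symmetric_spectral As.
have li : lambda i A \in codom d.
  rewrite /lambda (spectrumE Ad) -(mem_sort >=%R) mem_nth //.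
  by rewrite size_sort size_codom card_ord prednK.
have : eigenvalue A (lambda i A) by rewrite eigenvalue_root_char Ad root_prod_XsubC.
move=> /eigenvalueP[v vA v0]; exists v^T; first by rewrite trmx_eq0.
by rewrite -{1}As -trmx_mul vA linearZ.
Qed.

Lemma rayleigh (R : realType) k (A : 'M[R]_k) x : A^T = A -> (0 < k)%N ->
  lambda k A * dot x x <= dot x (A *m x) <= lambda 1 A * dot x x.
Proof.
case: k A x => // k A x As _; have [d Ad /(_ x)[w w0 Aw]] := symmetric_spectral As.
have /= := Aw 'X; rewrite horner_mx_X => ->.
have := Aw 1; rewrite rmorph1 mul1mx => ->.
have geT : transitive (>=%R : rel R) by move=> y z t /= yz zt; apply: le_trans zt yz.
have srt : sorted >=%R (spectrum A).
  by rewrite (spectrumE Ad) sort_sorted // => y z; apply: le_total.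
have sz : size (spectrum A) = k.+1.
  by rewrite (spectrumE Ad) size_sort size_codom card_ord.
have dk i : lambda k.+1 A <= d i <= lambda 1 A.
  have : d i \in spectrum A by rewrite (spectrumE Ad) mem_sort codom_f.
  move=> /(nthP 0)[j js <-]; rewrite /lambda /= sz in js *.
  have h := sorted_leq_nth geT (fun y => lexx y) 0 srt.
  by apply/andP; split; [apply: (h j k) | apply: (h 0%N j)]; rewrite ?inE ?sz.
rewrite !mulr_sumr; apply/andP; split; apply: ler_sum => i _; have /andP[]:= dk i;
  by move=> *; rewrite hornerC hornerX mul1r ler_wpM2r.
Qed.

(** * Positive definite matrices *)

Lemma symmetricmxE (R : fieldType) k (A : 'M[R]_k) :
  (A \is symmetricmx) = (A^T == A).
Proof. by rewrite qualifE /= expr0 scale1r map_mx_id // eq_sym. Qed.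

Lemma spd_tr (R : realType) k (A : 'M[R]_k) : spd A -> A^T = A.
Proof. by case; rewrite symmetricmxE => /eqP. Qed.

Lemma spd_gt0 (R : realType) k (A : 'M[R]_k) x : spd A -> x != 0 ->
  0 < dot x (A *m x).
Proof. by case=> _ /(_ x); rewrite /dot mulmxA. Qed.

Lemma spd_ge0 (R : realType) k (A : 'M[R]_k) x : spd A -> 0 <= dot x (A *m x).
Proof.
move=> Apd; have [->|x0] := eqVneq x 0; first by rewrite mulmx0 /dot mulmx0 mxE.
exact/ltW/spd_gt0.
Qed.

Lemma spd_unit (R : realType) k (A : 'M[R]_k) : spd A -> A \in unitmx.
Proof.
move=> Apd; rewrite -row_free_unit -kermx_eq0 -submx0.
apply/row_subP => i; rewrite submx0 -trmx_eq0.
have : row i (kermx A) *m A = 0 by rewrite -row_mul mulmx_ker row0.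
move: (row i _) => v vA; apply: contraT => v0; have := spd_gt0 Apd v0.
by rewrite -{1}(spd_tr Apd) -trmx_mul vA trmx0 /dot mulmx0 mxE ltxx.
Qed.

Lemma spd_lambda_gt0 (R : realType) k i (A : 'M[R]_k) :
  spd A -> (0 < i <= k)%N -> 0 < lambda i A.
Proof.
move=> Apd ik; have [v v0 Av] := lambda_eigenvector (spd_tr Apd) ik.
by have := spd_gt0 Apd v0; rewrite Av dotZr pmulr_lgt0 // dot_gt0.
Qed.

(** The inequality for the form of [A] at [x] and [A^-1 y]: the forms of [A]
    and of its inverse are dual to each other. *)
Lemma inv_cauchy_schwarz (R : realType) k (A : 'M[R]_k) x y : spd A ->
  dot x y ^+ 2 <= dot x (A *m x) * dot y (invmx A *m y).
Proof.
move=> Apd; have := psd_cauchy_schwarz x (invmx A *m y) (spd_tr Apd).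
rewrite mulKVmx ?spd_unit // [X in _ * X]dotC; apply=> z.
exact: spd_ge0.
Qed.

Lemma inv_form_ge0 (R : realType) k (A : 'M[R]_k) x : spd A ->
  0 <= dot x (invmx A *m x).
Proof.
move=> Apd; rewrite -{1}[x](mulKVmx (spd_unit Apd)) dotC.
exact: spd_ge0.
Qed.

(** With [y = A^-1 x], the Rayleigh bound [lambda k A * |y|^2 <= x . y] and
    Cauchy-Schwarz give [lambda k A * (x . y)^2 <= |x|^2 (x . y)]. *)
Lemma inv_form_le (R : realType) k (A : 'M[R]_k) x : (0 < k)%N -> spd A ->
  dot x (invmx A *m x) <= (lambda k A)^-1 * dot x x.
Proof.
move=> k0 Apd; set y := invmx A *m x.
have l0 : 0 < lambda k A by rewrite spd_lambda_gt0 // k0 leqnn.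
have /andP[yA _] := rayleigh y (spd_tr Apd) k0.
rewrite mulKVmx ?spd_unit // dotC in yA.
have := inv_form_ge0 x Apd; rewrite le0r -/y => /predU1P[->|xy].
  by rewrite mulr_ge0 ?dot_ge0 // invr_ge0 ltW.
rewrite ler_pdivlMl // -(ler_pM2r xy) -mulrA -expr2.
apply: (le_trans (ler_wpM2l (ltW l0) (cauchy_schwarz x y))).
by rewrite mulrCA ler_wpM2l ?dot_ge0.
Qed.

(** * Square root of a positive definite matrix *)

Lemma interpolation (F : fieldType) (g : F -> F) (s : seq F) :
  exists q : {poly F}, {in s, forall x, q.[x] = g x}.
Proof.
elim: s => [|x s [q IH]]; first by exists 0.
have [xs|xs] := boolP (x \in s).
  by exists q => y; rewrite inE => /predU1P[->|]; apply: IH.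
pose P := \prod_(y <- s) ('X - y%:P).
have Px : P.[x] != 0 by rewrite -/(root P x) root_prod_XsubC.
exists (q + ((g x - q.[x]) / P.[x]) *: P) => y.
rewrite inE hornerD hornerZ => /predU1P[->|ys].
  by rewrite divfK // addrC subrK.
have /rootP -> : root P y by rewrite root_prod_XsubC.
by rewrite mulr0 addr0 IH.
Qed.

Lemma horner_mx_tr (R : comNzRingType) k (A : 'M[R]_k.+1) q :
  A^T = A -> (horner_mx A q)^T = horner_mx A q.
Proof.
move=> As; elim/poly_ind: q => [|q c IH]; first by rewrite rmorph0 trmx0.
rewrite rmorphD rmorphM /= horner_mx_X horner_mx_C linearD /= tr_scalar_mx.
by rewrite trmx_mul IH As -(comm_horner_mx q (erefl (A *m A))).
Qed.

(** A polynomial [q] in [B] that interpolates the square root at the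
    eigenvalues of [B] is a square root of [B]: it is symmetric because [B] is,
    and [symmetric_spectral] gives both its positivity and the vanishing of the
    form of [q(B) ^+ 2 - B]. *)
Lemma sqrtmxP (R : realType) k (B : 'M[R]_k) : (0 < k)%N -> spd B ->
  spd (sqrtmx B) /\ sqrtmx B *m sqrtmx B = B.
Proof.
case: k B => // k B _ Bpd; have Bs := spd_tr Bpd.
suff exC : exists C : 'M[R]_k.+1, spd C /\ C *m C = B.
  exact: (@xgetPex _ 0 (fun C => spd C /\ C *m C = B)).
have [d Bd dB] := symmetric_spectral Bs.
have d_gt0 i : 0 < d i.
  have : eigenvalue B (d i).
    by rewrite eigenvalue_root_char Bd root_prod_XsubC codom_f.
  move=> /eigenvalueP[v vB v0]; have := @spd_gt0 _ _ _ v^T Bpd.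
  rewrite trmx_eq0 => /(_ v0); rewrite -{1}Bs -trmx_mul vB linearZ dotZr.
  by rewrite pmulr_lgt0 // dot_gt0 trmx_eq0.
have [q qd] := interpolation Num.sqrt (codom d).
have qs := horner_mx_tr q Bs.
exists (horner_mx B q); split.
  split=> [|x x0]; first by rewrite symmetricmxE qs.
  rewrite -mulmxA -/(dot _ _); have [w w0 xw] := dB x.
  have : 0 < dot x x by rewrite dot_gt0.
  have := xw 1; rewrite rmorph1 mul1mx => ->; rewrite xw => sw.
  have ge0 i : 0 <= q.[d i] * w i by rewrite qd ?codom_f // mulr_ge0 // sqrtr_ge0.
  rewrite lt0r sumr_ge0 // andbT; apply: contraTneq sw => /eqP.
  rewrite psumr_eq0 // => /allP s0.
  rewrite -leNgt big1 // => i _; rewrite hornerC mul1r; apply/eqP.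
  have := s0 i (mem_index_enum i); rewrite /= mulf_eq0 qd ?codom_f //.
  by rewrite sqrtr_eq0 leNgt d_gt0.
apply/eqP; rewrite -subr_eq0; apply/eqP.
have -> : horner_mx B q *m horner_mx B q - B = horner_mx B (q * q - 'X).
  by rewrite rmorphB rmorphM /= horner_mx_X.
apply: form_eq0_mx => [|x]; first exact: horner_mx_tr.
have [w _ ->] := dB x; apply: big1 => i _.
by rewrite !hornerE qd ?codom_f // -expr2 sqr_sqrtr ?subrr ?mul0r // ltW.
Qed.

(** * The 2-norm and the condition number *)

Section Norm.
Variable R : realType.

Lemma enorm_ge0 k (x : 'cV[R]_k) : 0 <= enorm x.
Proof. exact: sqrtr_ge0. Qed.

Lemma enormE k (x : 'cV[R]_k) : enorm x = Num.sqrt (dot x x).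
Proof. by rewrite /enorm dotE; under eq_bigr do rewrite expr2. Qed.

Lemma sqr_enorm k (x : 'cV[R]_k) : enorm x ^+ 2 = dot x x.
Proof. by rewrite enormE sqr_sqrtr // dot_ge0. Qed.

Lemma enorm_scale k a (x : 'cV[R]_k) : enorm (a *: x) = `|a| * enorm x.
Proof.
by rewrite !enormE dotZl dotZr mulrA -expr2 sqrtrM ?sqr_ge0 // sqrtr_sqr.
Qed.

Lemma enorm_eq0 k (x : 'cV[R]_k) : (enorm x == 0) = (x == 0).
Proof. by rewrite -sqrf_eq0 sqr_enorm dot_eq0. Qed.

Lemma enorm_le k l (x : 'cV[R]_k) (y : 'cV[R]_l) c : 0 <= c ->
  (enorm x <= c * enorm y) = (dot x x <= c ^+ 2 * dot y y).
Proof.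
by move=> c0; rewrite -!sqr_enorm -exprMn ler_sqr // nnegrE ?mulr_ge0 ?enorm_ge0.
Qed.

Lemma dot_le_enorm k (x y : 'cV[R]_k) : dot x y <= enorm x * enorm y.
Proof.
rewrite (le_trans (ler_norm _)) // -sqrtr_sqr !enormE -sqrtrM ?dot_ge0 //.
exact/ler_wsqrtr/cauchy_schwarz.
Qed.

Lemma mxnorm2_le m k (A : 'M[R]_(m, k)) c : 0 <= c ->
  (forall x, enorm (A *m x) <= c * enorm x) -> mxnorm2 A <= c.
Proof.
move=> c0 Ac; apply: ge_sup.
  by exists (enorm (A *m 0)), 0 => //=; rewrite enormE /dot mulmx0 mxE sqrtr0 ler01.
move=> _ [x /= x1 <-]; apply: le_trans (Ac x) _.
by rewrite -[leRHS]mulr1 ler_wpM2l.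
Qed.

(** The content is that the supremum defining [mxnorm2] is over a bounded set;
    the bound is the Rayleigh quotient of [A^T *m A]. *)
Lemma enorm_mulmx m k (A : 'M[R]_(m, k)) x : (0 < k)%N ->
  enorm (A *m x) <= mxnorm2 A * enorm x.
Proof.
move=> k0; have [->|x0] := eqVneq x 0.
  by rewrite mulmx0 !enormE /dot !mulmx0 !mxE sqrtr0 mulr0.
have n0 : 0 < enorm x by rewrite lt0r enorm_eq0 x0 enorm_ge0.
rewrite -ler_pdivrMr //; apply: ub_le_sup; last first.
  exists ((enorm x)^-1 *: x); rewrite /= ?enorm_scale.
    by rewrite ger0_norm ?invr_ge0 ?(ltW n0) // mulVf // gt_eqF.
  by rewrite -scalemxAr enorm_scale ger0_norm ?invr_ge0 ?(ltW n0) // mulrC.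
pose c := lambda 1 (A^T *m A).
exists (Num.sqrt `|c|) => _ [y /= y1 <-]; rewrite enormE ler_wsqrtr //.
have As : (A^T *m A)^T = A^T *m A by rewrite trmx_mul trmxK.
rewrite dot_mulmx mulmxA; have /andP[_] := rayleigh y As k0.
move/le_trans; apply; rewrite -/c -[leRHS]mulr1.
apply: (le_trans (ler_wpM2r (dot_ge0 y) (ler_norm c))).
by rewrite ler_wpM2l // -sqr_enorm expr_le1 // enorm_ge0.
Qed.

End Norm.

(** Passing from forms to norms: by Cauchy-Schwarz for the form of [S],
    [|S x|^4 = (S x . S x)^2 <= (S x . S (S x)) (x . S x)
    <= c |S x|^2 (x . S x)]. *)
Lemma mxnorm2_psd_le (R : realType) k (S : 'M[R]_k) c : S^T = S -> 0 <= c ->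
  (forall x, 0 <= dot x (S *m x) <= c * dot x x) -> mxnorm2 S <= c.
Proof.
move=> Ss c0 Sc; apply: mxnorm2_le => // x; rewrite enorm_le //.
have S0 z : 0 <= dot z (S *m z) by case/andP: (Sc z).
set y := S *m x; have [y0|y0] := eqVneq y 0.
  by rewrite y0 /dot mulmx0 mxE mulr_ge0 ?sqr_ge0 ?dot_ge0.
have := psd_cauchy_schwarz y x Ss S0.
have /andP[_ Sx] := Sc x; have /andP[_ Sy] := Sc y.
rewrite -/y -dot_gt0 in Sx y0 *; have := S0 x; rewrite -/y.
move: (dot x y) (dot y y) (dot x x) (dot y _) Sx Sy y0 => a b d e ad eb b0 a0 bae.
have bca : b <= c * a.
  rewrite -(ler_pM2r b0) -expr2 (le_trans bae) // (le_trans (ler_wpM2r a0 eb)) //.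
  by rewrite mulrAC.
by rewrite (le_trans bca) // expr2 -mulrA ler_wpM2l.
Qed.

Lemma form_le_mxnorm2 (R : realType) k (A : 'M[R]_k) x : (0 < k)%N ->
  dot x (A *m x) <= mxnorm2 A * dot x x.
Proof.
move=> k0; apply: le_trans (dot_le_enorm _ _) _.
by rewrite -sqr_enorm expr2 mulrCA ler_wpM2l ?enorm_ge0 ?enorm_mulmx.
Qed.

(** The hypotheses say that the smallest eigenvalue of [S] is 1, so that
    [S^-1] has norm 1. *)
Lemma cond2_fixed (R : realType) k (S : 'M[R]_k) (v : 'cV_k) : S^T = S ->
  (forall x, dot x x <= dot x (S *m x)) -> v != 0 -> S *m v = v ->
  cond2 S = mxnorm2 S.
Proof.
case: k S v => [|k] S v Ss S1 v0 Sv; first by rewrite flatmx0 eqxx in v0.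
have Spd : spd S.
  split=> [|x x0]; first by rewrite symmetricmxE Ss.
  by rewrite -mulmxA; apply: lt_le_trans (S1 x); rewrite dot_gt0.
have Su := spd_unit Spd.
suff -> : cond2 S = mxnorm2 S * 1 by rewrite mulr1.
congr (_ * _); apply/le_anti/andP; split.
  apply: mxnorm2_le => // x; rewrite mul1r; set y := invmx S *m x.
  have xE : x = S *m y by rewrite mulKVmx.
  have [y0|y0] := eqVneq y 0; first by rewrite y0 enormE /dot mulmx0 mxE sqrtr0 enorm_ge0.
  have n0 : 0 < enorm y by rewrite lt0r enorm_eq0 y0 enorm_ge0.
  rewrite -(ler_pM2l n0) -expr2 sqr_enorm (le_trans (S1 y)) // -xE.
  exact: dot_le_enorm.
have n0 : 0 < enorm v by rewrite lt0r enorm_eq0 v0 enorm_ge0.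
rewrite -(ler_pM2r n0) mul1r -{1}[v](mulKmx Su) Sv.
exact: enorm_mulmx.
Qed.

Lemma gram_lambda_ge0 (R : realType) m k i (H : 'M[R]_(m, k)) :
  (0 < i <= m)%N -> 0 <= lambda i (H *m H^T).
Proof.
have Gs : (H *m H^T)^T = H *m H^T by rewrite trmx_mul trmxK.
move=> im; have [v v0 Gv] := lambda_eigenvector Gs im.
rewrite -dot_gt0 in v0; rewrite -(pmulr_lge0 _ v0) -dotZr -Gv.
by rewrite -mulmxA -{1}[H]trmxK -dot_mulmx dot_ge0.
Qed.

(** The largest eigenvalue of [H *m H^T] also controls [H^T *m H]:
    [|H x|^4 = (x . H^T (H x))^2 <= |x|^2 |H^T (H x)|^2], and the last factor
    is the form of [H *m H^T] at [H x]. *)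
Lemma dot_mulmx_le (R : realType) m k (H : 'M[R]_(m, k)) x : (0 < m)%N ->
  dot (H *m x) (H *m x) <= lambda 1 (H *m H^T) * dot x x.
Proof.
move=> m0; set y := H *m x.
have Gs : (H *m H^T)^T = H *m H^T by rewrite trmx_mul trmxK.
have l0 : 0 <= lambda 1 (H *m H^T) by rewrite gram_lambda_ge0.
have [y0|] := eqVneq y 0.
  by rewrite y0 {1}/dot mulmx0 mxE mulr_ge0 ?dot_ge0.
rewrite -dot_gt0 => y_gt0.
have /andP[_] := rayleigh y Gs m0; rewrite -mulmxA -{1}[H]trmxK -dot_mulmx => Hy.
have yE : dot x (H^T *m y) = dot y y by rewrite -dot_mulmx.
have := cauchy_schwarz x (H^T *m y); rewrite yE expr2 => yy.
rewrite -(ler_pM2r y_gt0) (le_trans yy) // mulrAC mulrC.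
by rewrite ler_wpM2r ?dot_ge0.
Qed.

(** * Bounds for the preconditioned Hessian *)

Section Hessian.
Variables (R : realType) (N p : nat).
Variables (B : 'M[R]_N) (Rhat : 'M[R]_p) (H : 'M[R]_(p, N)).
Hypotheses (p_gt0 : (0 < p)%N) (p_lt_N : (p < N)%N).
Hypotheses (Bpd : spd B) (Rpd : spd Rhat).

Let N_gt0 : (0 < N)%N := leq_ltn_trans (leq0n p) p_lt_N.
Let S := precond_hessian B Rhat H.
Let W := H *m sqrtmx B.
Let C := sqrtmx B.

Let C_tr : C^T = C. Proof. by have [/spd_tr] := sqrtmxP N_gt0 Bpd. Qed.
Let C_sqr : C *m C = B. Proof. by have [] := sqrtmxP N_gt0 Bpd. Qed.

Lemma hessian_form x :
  dot x (S *m x) = dot x x + dot (W *m x) (invmx Rhat *m (W *m x)).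
Proof.
rewrite /S /precond_hessian mulmxDl mul1mx dotDr; congr (_ + _).
by rewrite dot_mulmx trmx_mul C_tr !mulmxA.
Qed.

Lemma hessian_tr : S^T = S.
Proof.
rewrite /S /precond_hessian linearD /= trmx1 !trmx_mul trmxK C_tr trmx_inv.
by rewrite (spd_tr Rpd) !mulmxA.
Qed.

(** This is where [p < N] enters: [W] maps to a space of smaller dimension, so
    it kills a nonzero vector, which [S] fixes. *)
Lemma cond2_hessian : cond2 S = mxnorm2 S.
Proof.
have : kermx W^T != 0.
  rewrite kermx_eq0 /row_free mxrank_tr ltn_eqF //.
  exact: leq_ltn_trans (rank_leq_row W) p_lt_N.
case/rowV0Pn => v /sub_kermxP vW v0.
apply: (@cond2_fixed _ _ _ v^T hessian_tr); rewrite ?trmx_eq0 //.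
  by move=> x; rewrite hessian_form lerDl inv_form_ge0.
rewrite /S /precond_hessian mulmxDl mul1mx -!mulmxA (mulmxA H) -/W.
by rewrite -[W *m _]trmxK trmx_mul trmxK vW trmx0 !mulmx0 addr0.
Qed.

Lemma cond2_hessian_ge1 : 1 <= cond2 S.
Proof.
pose x : 'cV[R]_N := const_mx 1.
have x0 : x != 0.
  apply/eqP => /matrixP /(_ (Ordinal N_gt0) 0); rewrite !mxE => /eqP.
  by rewrite oner_eq0.
rewrite -dot_gt0 in x0; rewrite -(ler_pM2r x0) mul1r cond2_hessian.
apply: le_trans (form_le_mxnorm2 _ _ N_gt0).
by rewrite hessian_form lerDl inv_form_ge0.
Qed.

Lemma cond2_hessian_le :
  cond2 S <= 1 + lambda 1 B / lambda p Rhat * lambda 1 (H *m H^T).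
Proof.
have lR : 0 < lambda p Rhat by rewrite spd_lambda_gt0 // p_gt0 leqnn.
have lB : 0 < lambda 1 B by rewrite spd_lambda_gt0.
have lG : 0 <= lambda 1 (H *m H^T) by rewrite gram_lambda_ge0.
rewrite cond2_hessian; apply: mxnorm2_psd_le => [||x]; first exact: hessian_tr.
  by rewrite addr_ge0 // mulr_ge0 // divr_ge0 // ltW.
rewrite hessian_form addr_ge0 ?dot_ge0 ?inv_form_ge0 //= mulrDl mul1r lerD2l.
apply: le_trans (inv_form_le _ p_gt0 Rpd) _.
rewrite [_ / _]mulrC -!mulrA ler_pM2l ?invr_gt0 // mulrCA -mulmxA.
apply: le_trans (dot_mulmx_le _ _ p_gt0) _; apply: ler_wpM2l => //.
have /andP[_] := rayleigh x (spd_tr Bpd) N_gt0; apply: le_trans.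
by rewrite dot_mulmx C_tr mulmxA C_sqr.
Qed.

(** With [x = W^T y], Cauchy-Schwarz for [Rhat] and [Rhat^-1] gives
    [(x . x)^2 = (y . W x)^2 <= (y . Rhat y) (W x . Rhat^-1 (W x))
    <= (y . Rhat y) (cond2 S - 1) (x . x)], and
    [x . x = H^T y . B (H^T y) >= lambda N B * (y . H H^T y)]. *)
Lemma obs_form_le y :
  lambda N B * dot y (H *m H^T *m y) <= (cond2 S - 1) * dot y (Rhat *m y).
Proof.
have WE : W *m W^T = H *m B *m H^T by rewrite trmx_mul C_tr -C_sqr !mulmxA.
pose x := W^T *m y; apply: (@le_trans _ _ (dot x x)).
  have -> : dot y (H *m H^T *m y) = dot (H^T *m y) (H^T *m y).
    by rewrite [RHS]dot_mulmx trmxK mulmxA.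
  have -> : dot x x = dot (H^T *m y) (B *m (H^T *m y)).
    by rewrite /x dot_mulmx trmxK (mulmxA W) WE [RHS]dot_mulmx trmxK !mulmxA.
  by have /andP[] := rayleigh (H^T *m y) (spd_tr Bpd) N_gt0.
have Sx : dot (W *m x) (invmx Rhat *m (W *m x)) <= (cond2 S - 1) * dot x x.
  by rewrite mulrBl mul1r lerBrDl -hessian_form cond2_hessian form_le_mxnorm2.
have [x0|] := eqVneq x 0.
  by rewrite x0 {1}/dot mulmx0 mxE mulr_ge0 ?subr_ge0 ?cond2_hessian_ge1 ?spd_ge0.
rewrite -dot_gt0 => x0; rewrite -(ler_pM2r x0) mulrAC.
have xE : dot y (W *m x) = dot x x by rewrite [RHS]dot_mulmx trmxK.
rewrite -expr2 -{1}xE (le_trans (inv_cauchy_schwarz _ _ Rpd)) // mulrC.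
by rewrite ler_wpM2r ?spd_ge0.
Qed.

End Hessian.

Lemma cond2_hessian_ge (R : realType) (N p : nat) (B : 'M[R]_N) (Rhat : 'M[R]_p)
    (H : 'M[R]_(p, N)) :
  (0 < p)%N -> (p < N)%N -> spd B -> spd Rhat ->
  1 + Num.max (lambda p (H *m H^T) * lambda N B / lambda p Rhat)
              (lambda 1 (H *m H^T) * lambda N B / lambda 1 Rhat)
    <= cond2 (precond_hessian B Rhat H).
Proof.
move=> p_gt0 p_lt_N Bpd Rpd; have N_gt0 := leq_ltn_trans (leq0n p) p_lt_N.
have pp : (0 < p <= p)%N by rewrite p_gt0 leqnn.
have p1 : (0 < 1 <= p)%N by [].
have Gs : (H *m H^T)^T = H *m H^T by rewrite trmx_mul trmxK.
have lB : 0 < lambda N B by rewrite spd_lambda_gt0 // N_gt0 leqnn.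
have c0 : 0 <= cond2 (precond_hessian B Rhat H) - 1.
  by rewrite subr_ge0 cond2_hessian_ge1.
have obs := obs_form_le H p_lt_N Bpd Rpd.
rewrite addrC -lerBrDr ge_max !ler_pdivrMr ?spd_lambda_gt0 //.
apply/andP; split.
  have [y y0 Ry] := lambda_eigenvector (spd_tr Rpd) pp.
  rewrite -dot_gt0 in y0; rewrite -(ler_pM2r y0) -mulrA.
  have /andP[Gy _] := rayleigh y Gs p_gt0.
  have := obs y; rewrite Ry dotZr [leRHS]mulrA; apply: le_trans.
  by rewrite mulrCA ler_pM2l.
have [y y0 Gy] := lambda_eigenvector Gs p1.
rewrite -dot_gt0 in y0; rewrite -(ler_pM2r y0) [leLHS]mulrAC mulrC -dotZr -Gy.
apply: le_trans (obs y) _; rewrite -mulrA ler_wpM2l //.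
by have /andP[] := rayleigh y (spd_tr Rpd) p_gt0.
Qed.

(** * Block diagonal observation error covariance *)

Lemma spd_mxdiag (R : realType) n (p_ : 'I_n -> nat)
    (R_ : forall i, 'M[R]_(p_ i)) :
  (forall i, spd (R_ i)) -> spd (\mxdiag_(i < n) R_ i).
Proof.
move=> Rpd; split=> [|x x0].
  by rewrite symmetricmxE tr_mxdiag; apply/eqP/eq_mxdiag => i; exact: spd_tr.
have xE : x = \mxcol_i submxcol x i by rewrite submxcolK.
have -> : (x^T *m \mxdiag_i R_ i *m x) 0 0 =
    \sum_i dot (submxcol x i) (R_ i *m submxcol x i).
  rewrite -mulmxA {1 2}xE mul_mxdiag_mxcol tr_mxcol mul_mxrow_mxcol.
  exact: summxE.
have ge0 i : 0 <= dot (submxcol x i) (R_ i *m submxcol x i) by exact: spd_ge0.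
rewrite lt0r sumr_ge0 // andbT; apply: contra x0.
rewrite psumr_eq0 // => /allP s0; rewrite xE; apply/eqP.
transitivity (\mxcol_(i < n) (0 : 'cV[R]_(p_ i))); last first.
  by apply/matrixP => i j; rewrite !mxE.
apply: eq_mxcol => i; apply/eqP; apply: contraTT (s0 i (mem_index_enum i)) => xi.
by rewrite /= gt_eqF // spd_gt0.
Qed.

Theorem corollary1 (R : realType) (n N : nat) (p_ : 'I_n.+1 -> nat)
    (B : 'M[R]_N)
    (R_ : forall i : 'I_n.+1, 'M[R]_(p_ i))
    (H_ : forall i : 'I_n.+1, 'M[R]_(p_ i, N))
    (M : nat -> 'M[R]_N) :
  let p := (\sum_i p_ i)%N in
  let Hhat := gen_obs H_ M in
  let Rhat := gen_obs_cov R_ in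
  let S := precond_hessian B Rhat Hhat in
  let G := Hhat *m Hhat^T in
  (0 < p)%N -> (p < N)%N ->
  spd B -> (forall i, spd (R_ i)) ->
  1 + Num.max (lambda p G * lambda N B / lambda p Rhat)
              (lambda 1 G * lambda N B / lambda 1 Rhat) <= cond2 S /\
  cond2 S <= 1 + lambda 1 B / lambda p Rhat * lambda 1 G.
Proof.
move=> p Hhat Rhat S G p_gt0 p_lt_N Bpd Rpd.
have Rhat_pd : spd Rhat by exact: spd_mxdiag.
by split; [exact: cond2_hessian_ge | exact: cond2_hessian_le].
Qed.
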